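(* Let $m>2$ be an integer and write the Binet polynomial as $b_m(\alpha)=\sum_{j=0}^{m-1}p_j(m)\alpha^j$. Then $p_0(m)=c_m=b_m(0)$ is negative, and all other coefficients are positive: $p_j(m)>0$ for $0<j\le m-1$. Moreover, for $1<j\le m-1$, $$p_j(m)=\frac{(-1)^{m-j}}{j(j-1)m}\left((m-j+1)\,S_{m-1}^{(j-2)}+(j-1)\left(\tfrac m2-1\right)S_{m-1}^{(j-1)}\right)$$ and also $$p_j(m)=\frac{(-1)^{m-j}}{j(j-1)m}\left((m-j+1)\,S_{m}^{(j-1)}+m\left(m-\tfrac j2-\tfrac12\right)S_{m-1}^{(j-1)}\right).$$ In particular, $p_2(m)=\frac14(m-2)!\left(1-\frac2m\right)$ and, for $m\ge4$, $p_3(m)=\frac16(m-2)!\left(1-\frac2m\right)\sum_{l=2}^{m-2}\frac1l$.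
   Context: $S_m^{(k)}$ denotes the (signed) Stirling number of the first kind, defined by $\prod_{k=0}^{m-1}(x-k)=\sum_{k=0}^{m}S_m^{(k)}x^k$. For $m\ge1$ the Binet polynomial is $$b_m(\alpha)=\frac1m\sum_{k=1}^{m}\left\{\frac{\alpha^{k+2}-(\alpha-1)^{k+2}}{k+2}+\frac{\left(\frac12-\alpha\right)\left(\alpha^{k+1}-(\alpha-1)^{k+1}\right)}{k+1}\right\}(-1)^{k-m}S_m^{(k)},$$ equivalently $b_m(\alpha)=\frac1m\int_{\alpha-1}^{\alpha}\left(x+\frac12-\alpha\right)\prod_{k=0}^{m-1}(k+x)\,dx$; it is a polynomial of degree $m-1$ in $\alpha$, and $p_j(m)$ is its coefficient of $\alpha^j$. *)

(* Defs.v *)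
From mathcomp Require Import all_boot all_order all_algebra.

Set Implicit Arguments.
Unset Strict Implicit.
Unset Printing Implicit Defensive.

Import Order.TTheory GRing.Theory Num.Theory.
Local Open Scope ring_scope.

(* Signed Stirling number of the first kind S_m^(k). It is 0 for k > m. *)
Definition stirling1 (m k : nat) : int :=
  (\prod_(0 <= i < m) ('X - (i%:R)%:P) : {poly int})`_k.

(* The Binet polynomial b_m, with 'X in the role of alpha. It is only
   meaningful for 0 < m, because of the factor 1 / m. The exponent k - m of -1
   is an integer subtraction. *)
Definition binet (R : numFieldType) (m : nat) : {poly R} :=
  m%:R^-1 *: \sum_(1 <= k < m.+1)
    ((-1) ^ (k%:Z - m%:Z) * (stirling1 m k)%:~R) *:
      (k.+2%:R^-1 *: ('X^(k.+2) - ('X - 1) ^+ k.+2)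
       + k.+1%:R^-1 *:
           (((2^-1)%:P - 'X) * ('X^(k.+1) - ('X - 1) ^+ k.+1))).

(* p_j(m) *)
Definition binet_coef (R : numFieldType) (j m : nat) : R := (binet R m)`_j.

(* Main.v *)
Require Import Defs.
From mathcomp Require Import all_boot all_order all_algebra.
From mathcomp Require Import ring lra zify.
Set Implicit Arguments.
Unset Strict Implicit.
Unset Printing Implicit Defensive.

Import Order.TTheory GRing.Theory Num.Theory.
Local Open Scope ring_scope.

(** Let [P x = x (x + 1) ... (x + m - 1)] and [Q = x (x + 1) ... (x + m - 2)].
    The integral form of the Binet polynomial gives
    [m b'' = (P' x + P' (x - 1)) / 2 - (P x - P (x - 1))
           = Q + (x + m / 2 - 1) Q' - m Q],
    whose coefficients are the announced combinations of Stirling numbers. For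
    [j >= 2] their positivity is a Maclaurin-type inequality between consecutive
    elementary symmetric functions of [1, ..., m - 2]. The signs of [p_0] and
    [p_1] come from the integrals of [(x + 1/2) P x] and [- P x] over [-1, 0]:
    shifted to [0, 1], they can be integrated monomial by monomial. *)

(** * Coefficients of (x + 1) ... (x + n), the unsigned Stirling numbers *)

Definition rising1 (R : nzRingType) (n : nat) : {poly R} :=
  \prod_(1 <= i < n.+1) ('X + i%:R%:P).

Lemma rising1S (R : nzRingType) n :
  rising1 R n.+1 = rising1 R n * ('X + n.+1%:R%:P).
Proof. by rewrite /rising1 big_nat_recr. Qed.

Lemma coef_rising1_0 (R : nzRingType) k : (rising1 R 0)`_k = (k == 0%N)%:R.
Proof. by rewrite /rising1 big_geq // coef1. Qed.

Lemma coef_rising1S (R : nzRingType) n k :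
  (rising1 R n.+1)`_k =
  (if k is k'.+1 then (rising1 R n)`_k' else 0) + (rising1 R n)`_k * n.+1%:R.
Proof. by rewrite rising1S mulrDr coefD coefMX coefMC; case: k. Qed.

(** Inequalities are proved over the totally ordered [int], then carried to [R] by this cast. *)
Lemma coef_rising1_int (R : nzRingType) n k :
  (rising1 R n)`_k = ((rising1 int n)`_k)%:~R.
Proof.
elim: n k => [|n IHn] k; first by rewrite !coef_rising1_0; case: (k == _).
rewrite !coef_rising1S intrD intrM (IHn k) mulrz_nat.
by congr (_ + _); case: k => [|k].
Qed.

Lemma coef_rising1_gt n k : (n < k)%N -> (rising1 int n)`_k = 0.
Proof.
elim: n k => [|n IHn] [|k] //; rewrite ?coef_rising1_0 // => ltnk.
by rewrite coef_rising1S !IHn ?mul0r ?addr0 // ltnW.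
Qed.

Lemma coef_rising1_lead n : (rising1 int n)`_n = 1.
Proof.
elim: n => [|n IHn]; first by rewrite coef_rising1_0.
by rewrite coef_rising1S IHn coef_rising1_gt // mul0r addr0.
Qed.

(** The coefficient is 1 + ... + (n + 1), doubled to stay in [int]. It makes the coefficient of
    degree m of b_m vanish. *)
Lemma coef_rising1_subl n : 2 * (rising1 int n.+1)`_n = n.+1%:R * n.+2%:R.
Proof.
elim: n => [|n IHn]; first by rewrite coef_rising1S !coef_rising1_0.
rewrite coef_rising1S coef_rising1_lead mulrDr IHn.
by rewrite -!natr1; ring.
Qed.

Lemma coef_rising1_ge0 n k : 0 <= (rising1 int n)`_k.
Proof.
elim: n k => [|n IHn] k; first by rewrite coef_rising1_0.
by rewrite coef_rising1S addr_ge0 ?mulr_ge0 //; case: k.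
Qed.

Lemma coef_rising1_gt0 n k : (k <= n)%N -> 0 < (rising1 int n)`_k.
Proof.
elim: n k => [|n IHn] k; first by rewrite leqn0 coef_rising1_0 => ->.
rewrite coef_rising1S; case: k => [_|k lekn].
  by rewrite add0r mulr_gt0 // IHn.
by rewrite ltr_wpDr ?IHn // mulr_ge0 // coef_rising1_ge0.
Qed.

(* The Maclaurin-type inequality [(r + 1) e_(r+1) <= (n - r) * (n + 1) / 2 * e_r]
   for the elementary symmetric functions of [1, ..., n], with [k = n - r - 1]. *)
Lemma coef_rising1_maclaurin n k :
  2 * (n%:R - k%:R) * (rising1 int n)`_k <=
  k.+1%:R * n.+1%:R * (rising1 int n)`_k.+1.
Proof.
elim: n k => [|n IHn] k.
  by rewrite !coef_rising1_0 /= mulr0 mulr_natr; case: k => //= k; rewrite mulr0n.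
have tk_ge0 : 0 <= (n%:R - k%:R) * (rising1 int n)`_k.
  have [lekn|ltnk] := leqP k n; last by rewrite (coef_rising1_gt ltnk) mulr0.
  by rewrite mulr_ge0 ?coef_rising1_ge0 // subr_ge0 ler_nat.
rewrite !coef_rising1S; have := IHn k.
case: k tk_ge0 => [|k] tk_ge0 IH1; last have IH2 := IHn k.
  rewrite -!natr1 /= in IH1 tk_ge0 *.
  move: (rising1 int n)`_0 (rising1 int n)`_1 (coef_rising1_ge0 n 0) IH1 tk_ge0 => a b.
  have : 0 <= n%:R :> int by [].
  move: (n%:R : int) => N; nra.
rewrite -!natr1 /= in IH1 IH2 tk_ge0 *.
move: IH1 IH2 tk_ge0.
have : 0 <= n%:R :> int by [].
move: (rising1 int n)`_k (rising1 int n)`_k.+1 (rising1 int n)`_k.+2 => a b c.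
move: (n%:R : int) (k%:R : int) => N K N0 H1 H2 H3.
(* The goal is the sum of [G1], [H2] and [H3]: the first two leave exactly (N - K - 1) b, which [H3]
   bounds. *)
have G1 : (N + 1 + 1) * (2 * (N - (K + 1)) * b) <=
          (N + 1 + 1) * ((K + 1 + 1) * (N + 1) * c).
  by rewrite ler_wpM2l //; lia.
nra.
Qed.

(** * Signed Stirling numbers of the first kind *)

Lemma stirling1_0 n : stirling1 n.+1 0 = 0.
Proof. by rewrite /stirling1 big_nat_recl // subr0 coefXM. Qed.

Lemma stirling1S n k :
  stirling1 n.+1 k =
  (if k is k'.+1 then stirling1 n k' else 0) - n%:R * stirling1 n k.
Proof.
rewrite /stirling1 big_nat_recr //= mulrBr coefB coefMX coefMC mulrC.
by case: k.
Qed.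

(** Replacing x by -x exchanges falling and rising factorials up to sign; here both sides obey the
    same recurrence. *)
Lemma stirling1_rising1 n k :
  stirling1 n.+1 k.+1 = (-1) ^+ (n + k) * (rising1 int n)`_k.
Proof.
elim: n k => [|n IHn] k.
  rewrite stirling1S mul0r subr0 /stirling1 big_geq // coef1 coef_rising1_0.
  by case: k => //= k; rewrite mulr0.
rewrite stirling1S IHn coef_rising1S; case: k => [|k].
  by rewrite stirling1_0 !addn0 exprS; ring.
by rewrite IHn !addnS addSn !exprS; ring.
Qed.

(** * Formal integration over [0, 1], and the shift by one *)

Lemma deriv_divXn (R : numFieldType) k :
  (k.+1%:R^-1 *: 'X^(k.+1) : {poly R})^`() = 'X^k.
Proof.
by rewrite derivZ derivXn -scaler_nat scalerA mulVf ?pnatr_eq0 // scale1r.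
Qed.

(** Integrates q W over [0, 1] by linearity in W. In characteristic zero, [G] and the combination of
    the [h k] differ by a constant. *)
Lemma horner01_integral (R : numFieldType) (G q W : {poly R}) (h : nat -> {poly R}) :
    G^`() = q * W -> (forall k, (h k)^`() = q * 'X^k) ->
  G.[1] - G.[0] = \sum_(k < size W) W`_k * ((h k).[1] - (h k).[0]).
Proof.
move=> dG dh; pose H := \sum_(k < size W) W`_k *: h k.
have dGH : (G - H)^`() = 0.
  rewrite derivB dG -[in q * W](coefK W) poly_def mulr_sumr /H raddf_sum.
  by rewrite -sumrB big1 // => k _; rewrite /= derivZ dh -scalerAr subrr.
have coefGH k : (G - H)`_k.+1 = 0.
  have /eqP := congr1 (fun p : {poly R} => p`_k) dGH.
  by rewrite coef_deriv coef0 mulrn_eq0 /= => /eqP.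
have -> : G = ((G - H)`_0)%:P + H.
  rewrite -[G in LHS](subrK H); congr (_ + _).
  by apply/polyP => -[|k]; rewrite coefC // coefGH.
rewrite !hornerE opprD addrACA subrr add0r /H !horner_sum -sumrB.
by apply: eq_bigr => k _; rewrite !hornerZ mulrBr.
Qed.

(** Each factor x + i becomes x + i - 1; hence P (x - 1) = (x - 1) Q. *)
Lemma comp_rising1_pred (R : comNzRingType) n :
  rising1 R n.+1 \Po ('X - 1) = 'X * rising1 R n.
Proof.
elim: n => [|n IHn].
  rewrite rising1S /rising1 big_geq // mul1r mulr1.
  by rewrite comp_polyD comp_polyX comp_polyC subrK.
rewrite rising1S comp_polyM IHn comp_polyD comp_polyX comp_polyC.
rewrite (rising1S _ n) -mulrA.
by congr (_ * (_ * _)); rewrite -natr1 polyCD; ring.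
Qed.

(** * Integral form of the Binet polynomial and its derivatives *)

Section BinetDeriv.

Variables (R : numFieldType) (n : nat).
Let m := n.+2.
Let S : {poly R} := 'X - 1.
Let T := rising1 R n.
Let P : {poly R} := 'X * rising1 R n.+1.
(** [F1] and [F2] are the antiderivatives of P and x P that vanish at 0. *)
Let F1 : {poly R} := \sum_(1 <= k < m.+1) P`_k *: (k.+1%:R^-1 *: 'X^(k.+1)).
Let F2 : {poly R} := \sum_(1 <= k < m.+1) P`_k *: (k.+2%:R^-1 *: 'X^(k.+2)).

(** The sign in [binet] cancels that of the Stirling number: their exponents have an even sum. *)
Lemma coef_binet_weight k :
  (0 < k)%N -> (-1) ^ (k%:Z - m%:Z) * (stirling1 m k)%:~R = P`_k.
Proof.
case: k => // k _; rewrite /m stirling1_rising1 /P coefXM [RHS]coef_rising1_int.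
rewrite rmorphM mulrA rmorphXn rmorphN1 -[(-1) ^+ _]/((-1) ^ (n.+1 + k)%N%:Z).
rewrite -expfzDr ?oppr_eq0 ?oner_eq0 //.
rewrite (_ : _ + _ = 2 * k%:Z); last by lia.
by rewrite -exprz_exp -[(-1) ^ 2]/((-1) ^+ 2) sqrrN expr1n exp1rz mul1r.
Qed.

Let binet_antideriv :
  binet R m = m%:R^-1 *: ((F2 - (F2 \Po S)) + ((2^-1)%:P - 'X) * (F1 - (F1 \Po S))).
Proof.
rewrite /binet /F1 /F2; congr (_ *: _).
rewrite !(raddf_sum (comp_poly S)) /= -!sumrB mulr_sumr -big_split /=.
rewrite !big_nat; apply: eq_bigr => k /andP[k_gt0 _].
rewrite coef_binet_weight // !comp_polyZ !comp_Xn_poly.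
by rewrite -!scalerBr -!scalerAr -scalerDr.
Qed.

Let sumP : \sum_(1 <= k < m.+1) P`_k *: 'X^k = P.
Proof.
have Pdef : P = \poly_(i < m.+1) P`_i.
  apply/polyP => j; rewrite coef_poly ltnS; case: leqP => // ltmj.
  rewrite /P coefXM; case: j ltmj => //= j ltmj.
  by rewrite coef_rising1_int coef_rising1_gt.
rewrite [RHS]Pdef poly_def -(big_mkord xpredT (fun k => P`_k *: 'X^k)) big_ltn //.
by rewrite {1}/P coefXM scale0r add0r.
Qed.

Let deriv_F1 : F1^`() = P.
Proof.
rewrite -[RHS]sumP /F1 raddf_sum /=; apply: eq_bigr => k _.
by rewrite derivZ deriv_divXn.
Qed.

Let deriv_F2 : F2^`() = 'X * P.
Proof.
rewrite -[P in RHS]sumP /F2 raddf_sum mulr_sumr /=; apply: eq_bigr => k _.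
by rewrite derivZ deriv_divXn -scalerAr exprS.
Qed.

Let comp_P : P \Po S = ('X - 1) * ('X * T).
Proof. by rewrite /P comp_polyM comp_polyX comp_rising1_pred. Qed.

Let half2 : (2^-1 : R)%:P * 2 = 1.
Proof. by rewrite -polyC_natr -polyCM mulVf // pnatr_eq0. Qed.

(** The boundary terms add up to (P x + P (x - 1)) / 2 = (x + n / 2) Q. *)
Lemma deriv_binet :
  (binet R m)^`() =
  m%:R^-1 *: (('X + n%:R%:P * (2^-1)%:P) * ('X * T) - (F1 - (F1 \Po S))).
Proof.
rewrite binet_antideriv derivZ; congr (_ *: _).
rewrite derivD derivM !derivB !deriv_comp derivC derivX deriv_F1 deriv_F2.
have -> : S^`() = 1 by rewrite /S derivB derivX derivC subr0.
rewrite comp_polyM comp_polyX comp_P /P rising1S -/T -natr1 polyCD /S.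
(* One half is an atom [h] for [ring], so the difference is factored through h * 2 - 1. *)
have := half2; move: (2^-1 : R)%:P => h hE.
rewrite polyC1; apply/eqP; rewrite -subr_eq0.
rewrite [X in X == 0](_ : _ = 'X * T * (h * 2 - 1)); last by ring.
by rewrite hE subrr mulr0.
Qed.

Lemma deriv2_binet :
  (binet R m)^`()^`() =
  m%:R^-1 *: ('X * T + ('X + n%:R%:P * (2^-1)%:P) * ('X * T)^`() - m%:R%:P * ('X * T)).
Proof.
rewrite deriv_binet derivZ; congr (_ *: _).
have dS : S^`() = 1 by rewrite /S derivB derivX derivC subr0.
rewrite derivB derivM derivB deriv_comp dS.
rewrite !derivM derivD derivX deriv_F1 comp_P.
have -> : (n%:R%:P * (2^-1)%:P)^`() = 0 :> {poly R} by rewrite -polyCM derivC.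
rewrite /P rising1S -/T /m -!natr1 !polyCD.
ring.
Qed.

(** Read off [deriv2_binet] with Q = x T: x Q' contributes k Q_k, and Q_(k+1) = T_k. *)
Lemma coef_binetSS k :
  m%:R * (k.+1%:R * k.+2%:R) * (binet R m)`_k.+2 =
  (n%:R / 2) * k.+1%:R * T`_k - (n.+1%:R - k%:R) * ('X * T)`_k.
Proof.
have /(congr1 (fun p : {poly R} => p`_k)) := deriv2_binet.
rewrite !coef_deriv -polyCM mulrDl -mulrnA.
set Q := 'X * T; have coefXQ : ('X * Q^`())`_k = k%:R * Q`_k.
  by rewrite coefXM; case: k => [|k]; rewrite ?mul0r // coef_deriv mulr_natl.
move: (binet R m) => b.
rewrite coefZ coefB !coefD !coefCM coefXQ coef_deriv (_ : Q`_k.+1 = T`_k) ?coefXM // => bE.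
rewrite -mulrA -natrM [_ * b`_ _]mulr_natl mulnC bE mulVKf ?pnatr_eq0 // -[T`_k *+ _]mulr_natr.
by rewrite /m -!natr1; ring.
Qed.

(** * Signs of p_0 and p_1 *)

Let coefT k : T`_k = ((rising1 int n)`_k)%:~R.
Proof. exact: coef_rising1_int. Qed.

(* After the shift to [0, 1], the integral of [(x + 1/2) * P x] over [-1, 0]
   becomes the integral of [(x - 1/2) * (x - 1) * x * T x]; all monomials of
   [T] but the constant one contribute negatively. *)
Lemma coef_binet0_lt0 : (0 < n)%N -> (binet R m)`_0 < 0.
Proof.
move=> n_gt0.
pose G := (F2 \Po S) + 2^-1 *: (F1 \Po S).
(* Antiderivative of x^k times (x - 1/2) (x - 1) x = x^3 - 3/2 x^2 + x/2. *)
pose h k : {poly R} := k.+4%:R^-1 *: 'X^(k.+4)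
  - (3 / 2) *: (k.+3%:R^-1 *: 'X^(k.+3)) + 2^-1 *: (k.+2%:R^-1 *: 'X^(k.+2)).
have dS : S^`() = 1 by rewrite /S derivB derivX derivC subr0.
have bE : (binet R m)`_0 = m%:R^-1 * (G.[1] - G.[0]).
  rewrite -horner_coef0 binet_antideriv /G /S !hornerE !horner_comp !hornerE.
  by rewrite ?subrr ?sub0r; ring.
rewrite bE pmulr_rlt0 ?invr_gt0 ?ltr0n // -oppr_gt0.
rewrite (@horner01_integral R G (('X - (2^-1)%:P) * ('X - 1) * 'X) T h); first last.
- move=> k; rewrite /h derivD derivB (derivZ (3 / 2)) (derivZ 2^-1) !deriv_divXn -!mul_polyC.
  have -> : (3 / 2)%:P = 3 * (2^-1)%:P :> {poly R} by rewrite polyCM polyC_natr.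
  rewrite !exprS; have := half2; move: (2^-1 : R)%:P => c hc.
  apply/eqP; rewrite -subr_eq0 [X in X == 0](_ : _ = 'X ^+ 2 * 'X ^+ k * (1 - c * 2)).
    by rewrite hc subrr mulr0.
  by ring.
- rewrite /G derivD derivZ !deriv_comp dS deriv_F1 deriv_F2 comp_polyM comp_polyX.
  rewrite comp_P /S -mul_polyC.
  have := half2; move: (2^-1 : R)%:P => c hc.
  apply/eqP; rewrite -subr_eq0 [X in X == 0](_ : _ = 'X * T * ('X - 1) * (c * 2 - 1)).
    by rewrite hc subrr mulr0.
  by ring.
have h01 k : (h k).[1] - (h k).[0] = - (k%:R / (2 * k.+2%:R * k.+3%:R * k.+4%:R)).
  rewrite /h !(hornerD, hornerN, hornerZ, hornerXn) !expr1n !expr0n /=.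
  rewrite !mulr0 !subr0 addr0 subr0 !mulr1.
  by rewrite -!natr1; field; rewrite !natr1 !pnatr_eq0.
under eq_bigr do rewrite h01 mulrN coefT.
rewrite sumrN opprK.
(* The constant monomial contributes 0; strictness comes from k = 1, present in [T] since n > 0. *)
have T1 : (1 < size T)%N.
  rewrite ltnNge; apply/negP => /leq_sizeP/(_ 1%N isT)/eqP.
  by rewrite coefT intr_eq0 gt_eqF ?coef_rising1_gt0.
rewrite (bigD1 (Ordinal T1)) //= ltr_wpDr //.
  apply: sumr_ge0 => i _; rewrite mulr_ge0 ?ler0z ?coef_rising1_ge0 //.
  by rewrite divr_ge0 ?mulr_ge0 ?ler0n.
by rewrite mulr_gt0 ?ltr0z ?coef_rising1_gt0 // divr_gt0 ?mulr_gt0 ?ltr0n.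
Qed.

(** At 0 the derivative reduces to minus the integral of P over [-1, 0], divided by m. Shifted to
    [0, 1], the integrand is (1 - x) x T. *)
Lemma coef_binet1_gt0 : 0 < (binet R m)`_1.
Proof.
pose G := F1 \Po S.
pose h k : {poly R} := k.+3%:R^-1 *: 'X^(k.+3) - k.+2%:R^-1 *: 'X^(k.+2).
have dS : S^`() = 1 by rewrite /S derivB derivX derivC subr0.
have bE : (binet R m)`_1 = m%:R^-1 * - (G.[1] - G.[0]).
  transitivity ((binet R m)^`()).[0]; first by rewrite horner_coef0 coef_deriv.
  rewrite deriv_binet /G /S !hornerE !horner_comp !hornerE.
  by rewrite /= mulr0 mul0r ?subrr ?sub0r.
rewrite bE pmulr_rgt0 ?invr_gt0 ?ltr0n //.
rewrite (@horner01_integral R G (('X - 1) * 'X) T h); first last.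
- by move=> k; rewrite /h derivB !deriv_divXn !exprS; ring.
- by rewrite /G deriv_comp dS deriv_F1 comp_P /S; ring.
have h01 k : (h k).[1] - (h k).[0] = - (k.+2%:R * k.+3%:R)^-1.
  rewrite /h !(hornerD, hornerN, hornerZ, hornerXn) !expr1n !expr0n /=.
  rewrite !mulr0 !subr0 !mulr1.
  by rewrite -!natr1; field; rewrite !natr1 !pnatr_eq0.
under eq_bigr do rewrite h01 mulrN coefT.
rewrite sumrN opprK.
have T0 : (0 < size T)%N.
  rewrite ltnNge; apply/negP => /leq_sizeP/(_ 0%N isT)/eqP.
  by rewrite coefT intr_eq0 gt_eqF ?coef_rising1_gt0.
rewrite (bigD1 (Ordinal T0)) //= ltr_wpDr //.
  apply: sumr_ge0 => i _; rewrite mulr_ge0 ?ler0z ?coef_rising1_ge0 //.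
  by rewrite invr_ge0 mulr_ge0 ?ler0n.
by rewrite mulr_gt0 ?ltr0z ?coef_rising1_gt0 // invr_gt0 mulr_gt0 ?ltr0n.
Qed.

End BinetDeriv.

(** * Coefficients p_j with j > 1: positivity, degree bound, closed forms *)

Lemma coefXrising1_int (R : nzRingType) n k :
  ('X * rising1 R n)`_k = (('X * rising1 int n)`_k)%:~R.
Proof. by rewrite !coefXM; case: k => //= k; rewrite coef_rising1_int. Qed.

Lemma stirling1_coefXrising1 n k :
  stirling1 n.+1 k = (-1) ^+ (n + k).+1 * ('X * rising1 int n)`_k.
Proof.
rewrite coefXM; case: k => [|k]; first by rewrite stirling1_0 mulr0.
by rewrite stirling1_rising1 addnS !exprS !mulN1r opprK.
Qed.

Lemma coef0_rising1 (R : nzRingType) n : (rising1 R n)`_0 = n`!%:R.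
Proof.
elim: n => [|n IHn]; first by rewrite coef_rising1_0.
by rewrite coef_rising1S add0r IHn factS mulnC natrM.
Qed.

Lemma coef1_rising1 (R : numFieldType) n :
  (rising1 R n)`_1 = n`!%:R * \sum_(1 <= l < n.+1) l%:R^-1.
Proof.
elim: n => [|n IHn]; first by rewrite coef_rising1_0 big_geq // mulr0.
rewrite coef_rising1S coef0_rising1 IHn factS natrM (big_nat_recr n.+1) // mulrDr.
have nz : n.+1%:R != 0 :> R by rewrite pnatr_eq0.
by move: (\sum_(_ <= _ < _) _) n`!%:R nz => x y; move: (n.+1%:R : R) => z nz; field.
Qed.


(* [2 * m * j * (j - 1) * p_j(m)] for [m = n + 2] and [j = k + 2]. *)
Definition binet_num (n k : nat) : int :=
  n%:R * k.+1%:R * (rising1 int n)`_k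
  - 2 * (n.+1%:R - k%:R) * ('X * rising1 int n)`_k.

(** By the Maclaurin-type inequality at k - 1, [binet_num n k] is at least n - k times the
    coefficient of degree k of [rising1 int n]. *)
Lemma binet_num_gt0 n k : (k < n)%N -> 0 < binet_num n k.
Proof.
rewrite /binet_num coefXM; case: k => [|k] ltkn /=.
  by rewrite mulr0 subr0 mulr1 mulr_gt0 ?ltr0n ?coef_rising1_gt0.
have := coef_rising1_maclaurin n k; have := coef_rising1_gt0 (ltnW ltkn).
move: (rising1 int n)`_k (rising1 int n)`_k.+1 => a b b_gt0.
have : k%:R + 2 <= n%:R :> int by rewrite -natrD ler_nat addn2.
rewrite -!natr1; move: (n%:R : int) (k%:R : int) => N K; nra.
Qed.

(** Bounds the degree of b_m by m - 1. The terms cancel for k = n, the factor n + 1 - k vanishes for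
    k = n + 1, and beyond that both coefficients vanish. *)
Lemma binet_num_eq0 n k : (n <= k)%N -> binet_num n k = 0.
Proof.
rewrite leq_eqVlt /binet_num => /predU1P[<-|].
  rewrite coef_rising1_lead coefXM; case: n => [|n] /=.
    by rewrite !mulr0 !mul0r subr0.
  have := coef_rising1_subl n; rewrite -!natr1.
  move: (rising1 int n.+1)`_n (n%:R : int) => a N; lia.
move=> ltnk; rewrite coef_rising1_gt // mulr0 sub0r.
have [->|neqk] := eqVneq k n.+1; first by rewrite subrr mulr0 mul0r oppr0.
rewrite coefXM; case: k ltnk neqk => // k ltnk neqk.
by rewrite /= coef_rising1_gt ?mulr0 ?oppr0 //; lia.
Qed.

Theorem mainTheorem7 (R : numFieldType) (m : nat) (hm : (2 < m)%N) :
  let p (j : nat) : R := binet_coef R j m in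
  [/\ binet R m = \sum_(0 <= j < m) p j *: 'X^j,
      p 0%N = (binet R m).[0] /\ p 0%N < 0,
      forall j : nat, (0 < j <= m - 1)%N -> 0 < p j,
      forall j : nat, (1 < j <= m - 1)%N ->
        p j = (-1) ^+ (m - j) / (j%:R * (j%:R - 1) * m%:R) *
              ((m%:R - j%:R + 1) * (stirling1 (m - 1) (j - 2))%:~R
               + (j%:R - 1) * (m%:R / 2 - 1)
                 * (stirling1 (m - 1) (j - 1))%:~R)
        /\
        p j = (-1) ^+ (m - j) / (j%:R * (j%:R - 1) * m%:R) *
              ((m%:R - j%:R + 1) * (stirling1 m (j - 1))%:~R
               + m%:R * (m%:R - j%:R / 2 - 1 / 2)
                 * (stirling1 (m - 1) (j - 1))%:~R)
    & p 2%N = 1 / 4 * ((m - 2)`!)%:R * (1 - 2 / m%:R)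
      /\
      ((4 <= m)%N ->
       p 3%N = 1 / 6 * ((m - 2)`!)%:R * (1 - 2 / m%:R)
             * \sum_(2 <= l < m - 1) l%:R^-1)].
Proof.
case: m hm => [|[|n]] // n_gt0 p; rewrite !ltnS in n_gt0.
have pSS k : p k.+2 = (n%:R / 2 * k.+1%:R * (rising1 R n)`_k
    - (n.+1%:R - k%:R) * ('X * rising1 R n)`_k) / (n.+2%:R * (k.+1%:R * k.+2%:R)).
  by rewrite -coef_binetSS mulrC mulKf // !mulf_neq0 ?pnatr_eq0.
have pnum k : p k.+2 = (binet_num n k)%:~R / (2 * (n.+2%:R * (k.+1%:R * k.+2%:R))).
  rewrite pSS /binet_num rmorphB !rmorphM rmorphB /= !rmorph_nat.
  rewrite -coef_rising1_int -coefXrising1_int -!natr1. field.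
  by rewrite !natr1 !pnatr_eq0.
have formula k : (k < n)%N ->
    p k.+2 = (-1) ^+ (n.+2 - k.+2) / (k.+2%:R * (k.+2%:R - 1) * n.+2%:R) *
      ((n.+2%:R - k.+2%:R + 1) * (stirling1 n.+1 k)%:~R
       + (k.+2%:R - 1) * (n.+2%:R / 2 - 1) * (stirling1 n.+1 k.+1)%:~R).
  move=> ltkn; rewrite pSS stirling1_coefXrising1 stirling1_rising1 !intrM !rmorphXn /= rmorphN1.
  rewrite -coef_rising1_int -coefXrising1_int.
  have sgnE : (-1) ^+ (n.+2 - k.+2) = (-1) ^+ (n + k) :> R.
    by rewrite !subSS -signr_odd oddB 1?ltnW // -oddD signr_odd.
  have sgn2 : (-1) ^+ (n + k) * (-1) ^+ (n + k) = 1 :> R by rewrite -expr2 sqrr_sign.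
  rewrite sgnE exprS; move: sgn2; set e := (-1) ^+ _ => sgn2.
  have -> : k.+2%:R - 1 = k.+1%:R :> R by rewrite -!natr1; ring.
  (* Inserting e * e = 1 on the left matches the two signs on the right, so [field] can treat [e] as
     an atom. *)
  rewrite -[LHS]mul1r -[X in X * _ = _]sgn2.
  rewrite -!natr1. field; rewrite !natr1 !pnatr_eq0 //.
split.
- apply/polyP => j; rewrite big_mkord -poly_def coef_poly; case: ltnP => //.
  case: j => [|[|k]] //; rewrite !ltnS => lenk; rewrite -[LHS]/(p k.+2) pnum.
  by rewrite binet_num_eq0 // mul0r.
- by rewrite /p /binet_coef horner_coef0; split; last exact: coef_binet0_lt0.
- case=> [|[|k]] //=; first by rewrite /p /binet_coef coef_binet1_gt0.
  rewrite subSS subn0 ltnS => ltkn; rewrite pnum divr_gt0 ?mulr_gt0 ?ltr0n //.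
  by rewrite ltr0z binet_num_gt0.
- case=> [|[|k]] //; rewrite !subSS !subn0 /= ltnS => ltkn.
  split; first by rewrite formula // subn0.
  (* The second formula is the first one after the recurrence for S_m^(j-1). *)
  rewrite formula // (stirling1S n.+1 k.+1) rmorphB /= intrM mulrz_nat.
  rewrite -!natr1 !addrK; field.
  by rewrite !natr1 ?pnatr_eq0.
- rewrite !subSS !subn0; split=> [|n_gt1].
    rewrite pSS coefXM /= mulr0 subr0 coef0_rising1.
    by rewrite -(natr1 n.+1) -(natr1 n); field; rewrite !natr1 !pnatr_eq0.
  (* The numerator n (T_1 - T_0) is n n! times the harmonic sum minus 1, which removes the term l =
     1. *)
  rewrite pSS coefXM /= coef0_rising1 coef1_rising1 (@big_ltn _ _ _ 1) //.
  rewrite invr1.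
  move: (\sum_(_ <= _ < _) _) => s.
  by rewrite -(natr1 n.+1) -(natr1 n); field; rewrite !natr1 !pnatr_eq0.
Qed.
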